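(* Let $\mathcal{U}$ be a connected open subset of $\mathbb{R}^n$ (resp. $\mathbb{C}^n$). Let $X_1,X_2$ be two analytic (resp. holomorphic) vector fields on $\mathcal{U}$, distinct and not identically zero. Assume that $X_1$ and $X_2$ satisfy the barycentric property. Then $\mathcal{F}_{X_1}=\mathcal{F}_{X_2}$, and it is a foliation by straight lines: (1) the closures of the generic leaves are intersections of lines with the open subset $\mathcal{U}$; (2) on each line the flow $\varphi_t^k=\exp(tX_k)$, $k=1,2$, coincides with the flow of a constant vector field.
   Context: For an analytic (resp. holomorphic) vector field $X$ on an open subset $\mathcal{U}$ of $\mathbb{R}^n$ (resp. $\mathbb{C}^n$), $\varphi_t=\exp(tX)$ denotes its local flow: $\frac{d}{dt}\varphi_t(x)=X(\varphi_t(x))$, $\varphi_0(x)=x$, defined for each $x\in\mathcal{U}$ and $t$ small enough. Vector fields $X_1,\dots,X_p$ on $\mathcal{U}$ satisfy the barycentric property if $\sum_{k=1}^p X_k(\exp(tX_k)(x))=0$ for all $x\in\mathcal{U}$ and all small $t$; equivalently $\sum_{k=1}^p\exp(tX_k)(x)=p\,x$. $\mathcal{F}_X$ denotes the (possibly singular) foliation of $\mathcal{U}$ by (real or complex) curves whose leaves are the integral curves of $X$. Lines are real (resp. complex) affine lines.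
   Formalization: In (1), the closure in U of a generic leaf is the connected component of (line ∩ U) containing the leaf, not all of line ∩ U: the literal claim fails for non-convex U, e.g. the plane minus a closed disc with X_1 = ∂/∂x = −X_2. *)

(* Defs.v *)
From HB Require Import structures.
From mathcomp Require Import all_boot all_order all_algebra finmap.
From mathcomp Require Import complex.
From mathcomp Require Import all_classical all_reals all_analysis.
From mathcomp.analysis.showcase Require summability.

Set Implicit Arguments.
Unset Strict Implicit.
Unset Printing Implicit Defensive.

Import Order.TTheory GRing.Theory Num.Theory.
Import numFieldNormedType.Exports.

Local Open Scope classical_set_scope.
Local Open Scope ring_scope.

Variant ground := Reals | Complexes.

(* Everything below is written over an arbitrary [K : numFieldType]; only
   [K = R] and [K = R[i]] are used. Over [R[i]], [is_derive] is the complex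
   derivative and [analytic_on] is holomorphy. *)
Definition scalars (R : realType) (g : ground) : numFieldType :=
  match g with Reals => R | Complexes => R[i] end.

Section Analytic.
Context {K : numFieldType} {n m : nat}.

Definition monomial (h : 'rV[K]_n) (alpha : {ffun 'I_n -> nat}) : K :=
  \prod_(i < n) h 0 i ^+ alpha i.

(* The power series is summed over all multi-indices along the filter of finite
   sets of multi-indices, i.e. unconditionally (hence absolutely). *)
Definition analytic_at (f : 'rV[K]_n -> 'rV[K]_m) (a : 'rV[K]_n) : Prop :=
  exists c : {ffun 'I_n -> nat} -> 'rV[K]_m,
    \forall h \near (0 : 'rV[K]_n),
      summability.partial_sum (fun alpha => monomial h alpha *: c alpha)
        @ summability.totally --> f (a + h).

Definition analytic_on (U : set 'rV[K]_n) (f : 'rV[K]_n -> 'rV[K]_m) : Prop :=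
  forall a, U a -> analytic_at f a.

End Analytic.

Section VectorFields.
Context {K : numFieldType} {n : nat}.
Implicit Types (U W L : set 'rV[K]_n) (X : 'rV[K]_n -> 'rV[K]_n).
Implicit Types (D : set K) (gamma : K -> 'rV[K]_n) (x : 'rV[K]_n).

(* A vector field on [U] is a total function whose values outside [U] are
   irrelevant. For [K = R] the domain [D] is an open interval. *)
Definition integral_curve U X D gamma : Prop :=
  [/\ open D, connected D
    & forall t, D t -> U (gamma t) /\ is_derive t (1 : K) gamma (X (gamma t))].

(* [gamma t = exp(tX)(x)] for [t] in the neighbourhood [D] of [0]. *)
Definition local_flow U X x D gamma : Prop :=
  [/\ integral_curve U X D gamma, D 0 & gamma 0 = x].

(* By uniqueness of integral curves it does not matter which local flows are
   chosen at [x]; "small [t]" means [t] in a common domain [D] around [0]. *)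
Definition barycentric (p : nat) U (X : 'I_p -> 'rV[K]_n -> 'rV[K]_n) : Prop :=
  forall x, U x -> exists (D : set K) (phi : 'I_p -> K -> 'rV[K]_n),
    (forall k, local_flow U (X k) x D (phi k)) /\
    (forall t, D t -> \sum_(k < p) X k (phi k t) = 0).

(* The leaf through [x]: the points reached from [x] by finitely many arcs of
   integral curves. Chains are needed for [K = R[i]], where the maximal integral
   curve may be multivalued in the complex time; for [K = R] this is the image
   of the maximal integral curve. *)
Inductive leaf U X x : 'rV[K]_n -> Prop :=
| leaf_refl : leaf U X x x
| leaf_step D gamma t0 t1 : integral_curve U X D gamma -> D t0 -> D t1 ->
    leaf U X x (gamma t0) -> leaf U X x (gamma t1).

(* A foliation is the set of its leaves; a zero of [X] is a leaf by itself. *)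
Definition foliation U X : set (set 'rV[K]_n) :=
  [set leaf U X x | x in U].

Definition regular_points U X : set 'rV[K]_n := U `&` [set x | X x != 0].

Definition generic_in U W : Prop :=
  [/\ W `<=` U, open W & U `<=` closure W].

Definition is_line L : Prop :=
  exists a v : 'rV[K]_n, v != 0 /\ L = [set a + t *: v | t in [set: K]].

Definition same_flow_on U (C : set 'rV[K]_n) X (Y : 'rV[K]_n -> 'rV[K]_n) : Prop :=
  forall D gamma t0, D t0 -> C (gamma t0) ->
    integral_curve U X D gamma <-> integral_curve U Y D gamma.

End VectorFields.

(* Main.v *)
(* At time 0 the barycentric property gives X_1 = - X_0, so it says that
   X_0 takes equal values along the flows of X_0 and of - X_0 issued from any
   point x. These two curves have opposite velocities at x, hence the
   derivative of X_0 at x in the direction X_0 x is equal to its own opposite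
   and vanishes. By the chain rule X_0 is then constant along every integral
   curve of X_0 or X_1, so integral curves are affine; uniqueness of solutions
   of differential equations is not needed. On the component of U meeting the
   line through x directed by X_k x, the set where X_0 = X_0 x is open (follow
   a local flow) and closed, hence it is the whole component, which is then a
   single leaf. Density of the regular points is the identity theorem. *)
Require Import Defs.
From mathcomp Require Import all_boot all_order all_algebra finmap.
From mathcomp Require Import complex.
From mathcomp Require Import all_classical all_reals all_analysis.
From mathcomp.analysis.showcase Require summability.

Import Order.TTheory GRing.Theory Num.Theory.
Import numFieldNormedType.Exports.

Local Open Scope classical_set_scope.
Local Open Scope ring_scope.

(** * Power series expansions *)

#[local] Existing Instance summability.totally_filter.

Lemma partial_sumE (I : choiceType) (V : zmodType) (u : I -> V) (A : {fset I}) :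
  summability.partial_sum u A = \sum_(i <- A) u i.
Proof. by rewrite /summability.partial_sum [RHS]big_seq_fsetE. Qed.

(** Adjoining to the finite set [A0] one index [i] outside it moves the partial sum by [u i]; both
    sums are within 1 of [l], hence the bound 2. The finitely many terms of [A0] are bounded by the
    sum of their norms. *)
Lemma summable_bounded (K : numFieldType) (V : normedModType K) (I : choiceType)
    (u : I -> V) (l : V) :
  summability.partial_sum u @ summability.totally --> l ->
  exists2 M : K, 0 <= M & forall i, `|u i| <= M.
Proof.
move=> /cvgrPdist_lt cvl; have [A0 _ near_l] := cvl 1 ltr01.
have sum_ge0 : 0 <= \sum_(i <- A0) `|u i| by apply: sumr_ge0.
exists (2 + \sum_(i <- A0) `|u i|) => [|i]; first by rewrite addr_ge0.
have [iA0|iA0] := boolP (i \in A0).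
  rewrite (big_fsetD1 i) //= addrCA lerDl addr_ge0 //.
  by apply: sumr_ge0.
have -> : u i = (l - \sum_(j <- A0) u j) - (l - \sum_(j <- i |` A0) u j)%fset.
  by rewrite big_fsetU1 //= opprB [RHS]addrC addrA subrK addrK.
rewrite (le_trans (ler_normB _ _)) // (@le_trans _ _ 2) ?lerDl //.
rewrite -[2]/(1 + 1) lerD // ltW // -partial_sumE; apply: near_l => /=.
  exact: fsubset_refl.
exact: fsubsetUr.
Qed.

(** * Multi-indices and monomials *)

Definition degree {n} (alpha : {ffun 'I_n -> nat}) : nat := \sum_i alpha i.

Lemma norm_coord {K : numFieldType} {n} (h : 'rV[K]_n) i : `|h 0 i| <= `|h|.
Proof.
rewrite [leRHS]/Num.norm /= mx_normE.
exact: (le_bigmax _ (fun ij : 'I_1 * 'I_n => `|h ij.1 ij.2|%:nng : {nonneg K}) (0, i)).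
Qed.

Lemma norm_monomial {K : numFieldType} {n} (h : 'rV[K]_n) alpha :
  `|monomial h alpha| <= `|h| ^+ degree alpha.
Proof.
rewrite /monomial normr_prod /degree -prodrXr; apply: ler_prod => i _.
rewrite normr_ge0 normrX lerXn2r ?nnegrE //.
exact: norm_coord.
Qed.

Lemma monomialZ {K : numFieldType} {n} (t : K) (h : 'rV[K]_n) alpha :
  monomial (t *: h) alpha = t ^+ degree alpha * monomial h alpha.
Proof.
rewrite /monomial /degree -prodrXr -big_split /=.
by apply: eq_bigr => i _; rewrite mxE exprMn.
Qed.

Lemma monomial_const {K : numFieldType} {n} (r : K) alpha :
  monomial (const_mx r : 'rV_n) alpha = r ^+ degree alpha.
Proof.
by rewrite /monomial /degree -prodrXr; apply: eq_bigr => i _; rewrite mxE.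
Qed.

Lemma continuous_monomial {K : numFieldType} {n} alpha :
  continuous (fun h : 'rV[K]_n => monomial h alpha).
Proof.
rewrite /monomial; apply: continuous_big => [|i _]; first exact: mul_continuous.
elim: (alpha i) => [|k IHk] h.
  by under eq_fun do rewrite expr0; apply: cst_continuous.
have -> : (fun g : 'rV[K]_n => g 0 i ^+ k.+1) = (fun g => g 0 i) \* (fun g => g 0 i ^+ k).
  by apply/funext => g; rewrite exprS.
apply: (@cvgM K _ (nbhs h) _ (fun g : 'rV[K]_n => g 0 i) (fun g => g 0 i ^+ k)).
  exact: coord_continuous.
exact: IHk.
Qed.

Lemma ler_sum_subseq (R : numDomainType) (I : eqType) (s1 s2 : seq I) (F : I -> R) :
  uniq s1 -> uniq s2 -> {subset s1 <= s2} -> (forall i, 0 <= F i) ->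
  \sum_(i <- s1) F i <= \sum_(i <- s2) F i.
Proof.
move=> us1 us2 s12 F0.
have /(perm_big _) -> : perm_eq s1 [seq i <- s2 | i \in s1].
  apply: uniq_perm => // [|i]; first exact: filter_uniq.
  by rewrite mem_filter andb_idr //; apply: s12.
rewrite big_filter [leRHS](bigID (mem s1)) /= lerDl.
by apply: sumr_ge0.
Qed.

(** Multi-indices with entries below [N] form a finite type, so sums over such a box are big
    operators to which distributivity applies. *)
Definition ffun_of_ord {n N} (f : {ffun 'I_n -> 'I_N}) : {ffun 'I_n -> nat} :=
  [ffun i => val (f i)].

Lemma ffun_of_ord_inj n N : injective (@ffun_of_ord n N).
Proof.
move=> f g /ffunP fg; apply/ffunP => i; apply: val_inj.
by have := fg i; rewrite !ffunE.
Qed.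

Lemma degree_ge {n} (alpha : {ffun 'I_n -> nat}) i : (alpha i <= degree alpha)%N.
Proof. by rewrite /degree (bigD1 i) //= leq_addr. Qed.

Lemma ffun_of_ord_lift {n} N (alpha : {ffun 'I_n -> nat}) :
  (degree alpha <= N)%N ->
  exists f : {ffun 'I_n -> 'I_N.+1}, ffun_of_ord f = alpha.
Proof.
move=> dN; exists [ffun i => inord (alpha i)]; apply/ffunP => i.
by rewrite !ffunE /= inordK // ltnS (leq_trans (degree_ge _ _)).
Qed.

Lemma sum_half_pow_le2 (R : numFieldType) N : \sum_(j < N) (2^-1 : R) ^+ j <= 2.
Proof.
suff -> : \sum_(j < N) (2^-1 : R) ^+ j = 2 - 2 * 2^-1 ^+ N.
  by rewrite gerBl mulr_ge0 // exprn_ge0 // invr_ge0.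
elim: N => [|N IHN]; first by rewrite big_ord0 expr0 mulr1 subrr.
rewrite big_ord_recr /= IHN exprS mulrA mulfV ?pnatr_eq0 // mul1r.
by rewrite [2 * _]mulr_natl mulr2n opprD addrA subrK.
Qed.

(** The finite set [A] lies in a box of multi-indices; over the box the sum factors into [n]
    geometric sums, each at most 2. *)
Lemma sum_half_pow_degree (R : numFieldType) n (A : {fset {ffun 'I_n -> nat}}) :
  \sum_(alpha <- A) (2^-1 : R) ^+ degree alpha <= 2 ^+ n.
Proof.
pose N := (\max_(alpha <- A) degree alpha)%N.
pose s := [seq ffun_of_ord f | f : {ffun 'I_n -> 'I_N.+1}].
apply: (@le_trans _ _ (\sum_(alpha <- s) (2^-1 : R) ^+ degree alpha)).
  apply: ler_sum_subseq => // [|alpha alphaA].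
    by rewrite map_inj_uniq ?enum_uniq //; apply: ffun_of_ord_inj.
  have [|f <-] := @ffun_of_ord_lift _ N alpha; first exact: leq_bigmax_seq.
  by rewrite map_f // mem_enum.
rewrite big_map big_enum /=.
under eq_bigr => f _.
  rewrite /degree -prodrXr.
  under eq_bigr do rewrite ffunE.
  over.
rewrite -(bigA_distr_bigA (fun _ (j : 'I_N.+1) => (2^-1 : R) ^+ j)) /=.
rewrite prodr_const card_ord lerXn2r ?nnegrE ?ler0n //.
  by apply: sumr_ge0 => *; rewrite exprn_ge0 // invr_ge0.
exact: sum_half_pow_le2.
Qed.

Lemma sum_degree_lt (V : nmodType) (I : Type) (s : seq I) (d : I -> nat) (u : I -> V) k :
  \sum_(j < k) \sum_(i <- s | d i == j) u i = \sum_(i <- s | (d i < k)%N) u i.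
Proof.
rewrite (exchange_big_dep (fun i => d i < k)%N) /=; last by move=> j i _ /eqP->.
apply: eq_bigr => i di; rewrite (big_pred1 (Ordinal di)) //.
Qed.

Section Expansion.
Context {K : numFieldType} {n m : nat}.
Implicit Types (f : 'rV[K]_n -> 'rV[K]_m) (h : 'rV[K]_n).

(** A multi-index of degree [j] has entries at most [j], so this finite sum is the whole degree [j]
    part of the series. *)
Definition homogeneous_part (c : {ffun 'I_n -> nat} -> 'rV[K]_m) (j : nat) h :=
  \sum_(g : {ffun 'I_n -> 'I_j.+1} | degree (ffun_of_ord g) == j)
    monomial h (ffun_of_ord g) *: c (ffun_of_ord g).

Lemma homogeneous_partZ c j t h :
  homogeneous_part c j (t *: h) = t ^+ j *: homogeneous_part c j h.
Proof.
rewrite scaler_sumr; apply: eq_bigr => g /eqP dg.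
by rewrite monomialZ dg scalerA.
Qed.

Lemma continuous_homogeneous_part c j : continuous (homogeneous_part c j).
Proof.
apply: continuous_big => [|g _ h]; first exact: add_continuous.
exact: (cvgZr_tmp (@continuous_monomial K n (ffun_of_ord g) h)).
Qed.

Lemma homogeneous_part_sum c j h (A : {fset {ffun 'I_n -> nat}}) :
  (forall alpha, (degree alpha <= j)%N -> alpha \in A) ->
  homogeneous_part c j h =
    \sum_(alpha <- A | degree alpha == j) monomial h alpha *: c alpha.
Proof.
move=> jA; rewrite -[RHS]big_filter.
have -> : homogeneous_part c j h =
    \sum_(alpha <- [seq ffun_of_ord g | g : {ffun 'I_n -> 'I_j.+1}] |
            degree alpha == j) monomial h alpha *: c alpha.
  by rewrite big_map big_enum_cond.
rewrite -[LHS]big_filter; apply: perm_big; apply: uniq_perm => [||alpha].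
- by rewrite filter_uniq // map_inj_uniq ?enum_uniq //; apply: ffun_of_ord_inj.
- exact/filter_uniq/fset_uniq.
rewrite !mem_filter; apply: andb_id2l => /eqP dj; rewrite jA ?dj //.
have [|g <-] := @ffun_of_ord_lift _ j alpha; first by rewrite dj.
by rewrite map_f // mem_enum.
Qed.

(** Summability at the vector with all coordinates [r] bounds the coefficients of degree [d] by a
    multiple of [r ^- d]. In a ball of half that radius, the terms of degree at least [k] are
    dominated by [q ^+ k] times a summable family of powers of 1/2. *)
Lemma analytic_at_expansion f a : analytic_at f a ->
  exists c (rho M : K), [/\ 0 < rho, 0 <= M
    & forall h k, `|h| <= rho ->
      `|f (a + h) - \sum_(j < k) homogeneous_part c j h| <= M * (`|h| / rho) ^+ k].
Proof.
case=> c /nbhs_ballP[e /= e0 cvgf].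
pose r := e / 2; have r0 : 0 < r by rewrite divr_gt0.
have re : r < e by rewrite ltr_pdivrMr // ltr_pMr // ltr1n.
clearbody r.
have [M M0 cM] : exists2 M : K, 0 <= M &
    forall alpha, r ^+ degree alpha * `|c alpha| <= M.
  have /cvgf/summable_bounded[M M0 cM] : ball 0 e (const_mx r : 'rV[K]_n).
    split=> // i j; rewrite !mxE -ball_normE /= sub0r normrN gtr0_norm //.
  exists M => // alpha; apply: le_trans (cM alpha).
  by rewrite normrZ monomial_const normrX gtr0_norm.
(* Halving [r] leaves a factor [2^-1 ^+ degree alpha] in each term; these factors sum to at most
   [2 ^+ n]. *)
exists c, (r / 2), (M * 2 ^+ n).
split=> [||h k hr]; [by rewrite divr_gt0 | by rewrite mulr_ge0 // exprn_ge0 |].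
set q := `|h| / (r / 2).
have q0 : 0 <= q by rewrite divr_ge0 // ltW // divr_gt0.
have q1 : q <= 1 by rewrite ler_pdivrMr ?mul1r // divr_gt0.
have hq : `|h| = q * 2^-1 * r.
  by rewrite /q -mulrA [2^-1 * r]mulrC divfK // gt_eqF // divr_gt0.
clearbody q.
have /cvgf/cvgrPdist_lt cvgh : ball 0 e h.
  rewrite -ball_normE /= sub0r normrN (le_lt_trans hr) //.
  by rewrite (@le_lt_trans _ _ r) // ler_piMr ?(ltW r0) // invf_le1 ?ler1n.
have qh alpha : `|monomial h alpha *: c alpha| <=
    M * (q ^+ degree alpha * 2^-1 ^+ degree alpha).
  rewrite normrZ (le_trans (ler_wpM2r _ (norm_monomial _ _))) //.
  rewrite hq !exprMn -[leLHS]mulrA [leLHS]mulrC ler_wpM2r ?cM //.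
  by rewrite mulr_ge0 ?exprn_ge0 ?invr_ge0.
apply/ler_addgt0Pr => d d0.
have [A0 _ near_f] := cvgh _ d0.
(* Containing [A0] puts the partial sum within [d] of [f (a + h)]; containing all degrees up to [k]
   makes the homogeneous parts below [k] complete. *)
pose A := (A0 `|` [fset alpha in [seq ffun_of_ord g | g : {ffun 'I_n -> 'I_k.+1}]])%fset.
have kA alpha : (degree alpha <= k)%N -> alpha \in A.
  move=> /ffun_of_ord_lift[g <-].
  by rewrite in_fsetU inE map_f ?orbT // mem_enum.
have {near_f}fA : `|f (a + h) - \sum_(alpha <- A) monomial h alpha *: c alpha| < d.
  by rewrite -partial_sumE; apply: near_f => /=; exact: fsubsetUl.
rewrite -(subrKA (\sum_(alpha <- A) monomial h alpha *: c alpha)).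
rewrite (le_trans (ler_normD _ _)) // addrC lerD // ?(ltW fA) //.
have -> : \sum_(j < k) homogeneous_part c j h =
    \sum_(alpha <- A | (degree alpha < k)%N) monomial h alpha *: c alpha.
  rewrite -sum_degree_lt; apply: eq_bigr => j _; apply: homogeneous_part_sum.
  by move=> alpha dj; apply: kA; rewrite (leq_trans dj) // ltnW.
rewrite (bigID (fun alpha => degree alpha < k)%N) /= addrAC subrr add0r.
rewrite (le_trans (ler_norm_sum _ _ _)) //.
apply: (@le_trans _ _ (\sum_(alpha <- A) M * q ^+ k * 2^-1 ^+ degree alpha)); last first.
  rewrite -mulr_sumr mulrAC ler_wpM2r ?exprn_ge0 // ler_wpM2l //.
  exact: sum_half_pow_degree.
rewrite big_mkcond; apply: ler_sum => alpha _.
case: ifPn => [|_]; last by rewrite !mulr_ge0 ?exprn_ge0 ?invr_ge0.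
rewrite -leqNgt => kd; apply: (le_trans (qh _)).
rewrite mulrA ler_wpM2r ?exprn_ge0 ?invr_ge0 // ler_wpM2l //.
exact: ler_wiXn2l.
Qed.

End Expansion.

(** * Derivatives of curves *)

Section DifferenceQuotient.
Context {K : numFieldType} {V : normedModType K}.
Implicit Types (g : K -> V) (t : K) (v : V).

Lemma is_derive_cvgP g t v : is_derive t (1 : K) g v <->
  h^-1 *: (g (t + h) - g t) @[h --> 0^'] --> v.
Proof.
have E : (fun h => h^-1 *: ((g \o shift t) (h *: (1 : K)) - g t)) =
    (fun h => h^-1 *: (g (t + h) - g t)).
  by apply/funext => h /=; rewrite [_%:A]mulr1 [h + t]addrC.
split=> [[dg <-]|cg]; first by rewrite -E; exact: dg.
split; first by rewrite /derivable E; apply/cvg_ex; exists v.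
by rewrite /derive E; apply: cvg_lim.
Qed.

(** With the denominator cleared, the condition also makes sense for the increment 0, and a full
    neighbourhood replaces the punctured one. *)
Lemma is_derive_distP g t v : is_derive t (1 : K) g v <->
  forall e : K, 0 < e ->
    \forall h \near (0 : K), `|g (t + h) - g t - h *: v| <= e * `|h|.
Proof.
rewrite is_derive_cvgP; split=> [/cvgrPdist_le cg e e0|dg].
  have := cg e e0; rewrite near_withinE; apply: filterS => h cgh.
  have [->|h0] := eqVneq h 0; first by rewrite addr0 subrr scale0r subr0 !normr0 mulr0.
  rewrite -ler_pdivrMr ?normr_gt0 // mulrC -normfV -normrZ scalerBr scalerA.
  by rewrite mulVf // scale1r distrC; apply: cgh.
apply/cvgrPdist_le => e e0; rewrite near_withinE.
apply: filterS (dg e e0) => h + h0.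
rewrite -ler_pdivrMr ?normr_gt0 // mulrC -normfV -normrZ scalerBr scalerA.
by rewrite mulVf // scale1r distrC.
Qed.

Lemma is_derive_continuous g t v : is_derive t (1 : K) g v -> {for t, continuous g}.
Proof.
by move=> [dg _]; apply: differentiable_continuous; apply/derivable1_diffP.
Qed.

End DifferenceQuotient.

(** * Continuity and chain rule for analytic maps *)

Section AnalyticCalculus.
Context {K : numFieldType} {n m : nat}.
Variables (f : 'rV[K]_n -> 'rV[K]_m) (a : 'rV[K]_n).
Hypothesis fa : analytic_at f a.

Lemma homogeneous_part0 (c : {ffun 'I_n -> nat} -> 'rV[K]_m) h :
  homogeneous_part c 0 h = homogeneous_part c 0 0.
Proof. by rewrite -[in RHS](scale0r h) homogeneous_partZ expr0 scale1r. Qed.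

Lemma analytic_at_dist : exists c (rho M : K), [/\ 0 < rho, 0 <= M,
  forall h, `|h| <= rho -> `|f (a + h) - f a| <= M * `|h| &
  forall h, `|h| <= rho ->
    `|f (a + h) - f a - homogeneous_part c 1 h| <= M * `|h| ^+ 2].
Proof.
have [c [rho [M [rho0 M0 cM]]]] := analytic_at_expansion f a fa.
(* For the increment 0 the remainder of order 1 is bounded by 0, so the constant term is [f a]. *)
have cfa h : homogeneous_part c 0 h = f a.
  rewrite homogeneous_part0; apply/esym/eqP; rewrite -subr_eq0 -normr_le0.
  have := cM 0 1%N; rewrite normr0 big_ord1 addr0 mul0r expr1 mulr0.
  by apply; apply: ltW.
(* The first summand serves the estimate of order 1, the second that of order 2. *)
exists c, rho, (M * rho^-1 + M * rho^-1 ^+ 2); split=> //.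
- by rewrite addr_ge0 // mulr_ge0 ?exprn_ge0 ?invr_ge0 // ltW.
- move=> h hr; have := cM h 1%N hr; rewrite big_ord1 cfa => /le_trans; apply.
  rewrite mulrDl expr1 [_ / rho]mulrC mulrA lerDl mulr_ge0 // mulr_ge0 //.
  by rewrite exprn_ge0 // invr_ge0 ltW.
- move=> h hr; have := cM h 2 hr; rewrite big_ord_recr big_ord1 /= cfa opprD addrA.
  move=> /le_trans; apply; rewrite exprMn [_ * rho^-1 ^+ 2]mulrC mulrA mulrDl lerDr.
  by rewrite mulr_ge0 ?exprn_ge0 // mulr_ge0 // invr_ge0 ltW.
Qed.

Lemma analytic_at_continuous : {for a, continuous f}.
Proof.
have [c [rho [M [rho0 M0 dist1 _]]]] := analytic_at_dist.
have M1 : 0 < M + 1 by rewrite ltr_wpDl.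
have near_a d : 0 < d -> \forall y \near a, `|y - a| <= d.
  by move=> d0; apply: (@cvgr_distC_le _ _ _ (nbhs a) _ id a).
suff cvf e : 0 < e -> \forall y \near a, `|f a - f y| <= e.
  by apply/(@cvgrPdist_le _ _ _ (nbhs a)) => e e0; apply: cvf.
move=> e0; near=> y.
have yrho : `|y - a| <= rho by near: y; apply: near_a.
have yM : `|y - a| <= (M + 1)^-1 * e.
  by near: y; apply: near_a; rewrite mulr_gt0 // invr_gt0.
rewrite distrC -[y](subrK a) [y - a + a]addrC (le_trans (dist1 _ yrho)) //.
apply: (@le_trans _ _ ((M + 1) * `|y - a|)); first by rewrite ler_wpM2r // lerDl.
by rewrite -ler_pdivlMl.
Unshelve. all: by end_near. Qed.

(* [L] is the degree one part of the expansion of [f] at [a]; its additivity is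
   never needed. *)
Lemma is_derive_analytic_comp : exists L : 'rV[K]_n -> 'rV[K]_m,
  (forall v, L (- v) = - L v) /\
  forall (g : K -> 'rV[K]_n) t v, g t = a ->
    is_derive t (1 : K) g v -> is_derive t (1 : K) (f \o g) (L v).
Proof.
have [c [rho [M [rho0 M0 _ dist2]]]] := analytic_at_dist.
exists (homogeneous_part c 1); split=> [v|g t v gta dg].
  by rewrite -scaleN1r homogeneous_partZ expr1 scaleN1r.
have gc := is_derive_continuous _ _ _ dg.
have tcv : t + h @[h --> 0^'] --> t.
  have : t + h @[h --> 0^'] --> t + 0.
    by apply: cvgD; [exact: cvg_cst | exact: cvg_within].
  by rewrite addr0.
have dcv : g (t + h) - a @[h --> 0^'] --> (0 : 'rV[K]_n).
  rewrite -(subrr a) -{2}gta; apply: cvgB; last exact: cvg_cst.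
  exact: (cvg_comp _ _ tcv gc).
move/is_derive_cvgP : dg => dg; apply/is_derive_cvgP => /=.
rewrite gta in dg *.
have L1 : homogeneous_part c 1 (h^-1 *: (g (t + h) - a)) @[h --> 0^'] -->
    homogeneous_part c 1 v.
  by apply: (cvg_comp _ _ dg); apply: continuous_homogeneous_part.
apply: (cvg_sub0 _ L1); apply/cvgr0Pnorm_le => e e0.
(* Divided by [h], the quadratic remainder is at most [M] times the norm of the difference quotient,
   which converges, times that of [g (t + h) - a], which tends to 0. *)
have B0 : M * (`|h^-1 *: (g (t + h) - a)| * `|g (t + h) - a|) @[h --> 0^'] --> (0 : K).
  have := cvgMl_tmp (a := M) (cvgM (cvg_norm dg) (cvg_norm dcv)).
  by rewrite normr0 !mulr0; apply.
near=> h.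
have dh : `|g (t + h) - a| <= rho by near: h; exact: (cvgr0_norm_le _ dcv _ rho0).
have Bh : `|M * (`|h^-1 *: (g (t + h) - a)| * `|g (t + h) - a|)| <= e.
  by near: h; exact: (cvgr0_norm_le _ B0 _ e0).
rewrite ger0_norm ?mulr_ge0 // in Bh.
have := dist2 _ dh; rewrite [a + _]addrC subrK => le2.
suff : `|h^-1 *: (f (g (t + h)) - f a) -
    homogeneous_part c 1 (h^-1 *: (g (t + h) - a))| <= e by [].
rewrite homogeneous_partZ expr1 -scalerBr normrZ; apply: le_trans Bh.
by rewrite normrZ -mulrA mulrCA ler_wpM2l // -expr2.
Unshelve. all: by end_near. Qed.

End AnalyticCalculus.

(** * Curves and segments *)

(** The interiors of [P] and of its complement show that the trace of [P] on [D] is open and closed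
    in [D]. *)
Lemma connected_clopen_ind (T : topologicalType) (D P : set T) (t0 : T) :
  connected D -> D t0 -> P t0 ->
  (forall t, D t -> P t -> \forall u \near t, P u) ->
  (forall t, D t -> ~ P t -> \forall u \near t, ~ P u) ->
  D `<=` P.
Proof.
move=> cD Dt0 Pt0 oP cP; suff <- : D `&` P = D by move=> t [].
apply: cD; first by exists t0.
- exists P^°; first exact: open_interior.
  apply/seteqP; split=> t [Dt Pt]; split=> //; first exact: oP.
  exact: nbhs_singleton Pt.
- exists (~` (~` P)^°); first exact/open_closedC/open_interior.
  apply/seteqP; split=> t [Dt Pt]; split=> //; first by move=> /nbhs_singleton.
  by apply: contrapT => nPt; apply: Pt; apply: cP.
Qed.

Lemma near_neq (K : numFieldType) (T : topologicalType) (V : normedModType K)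
    (f : T -> V) y c :
  {for y, continuous f} -> f y <> c -> \forall z \near y, f z <> c.
Proof.
move=> fc fy; apply: (fc [set~ c]); apply: open_nbhs_nbhs; split=> //.
apply: closed_openC; apply: accessible_closed_set1; apply: hausdorff_accessible.
exact: norm_hausdorff.
Qed.

(** * Affine curves and time reversal *)

Section Flows.
Context {K : numFieldType} {n : nat}.
Implicit Types (U D : set 'rV[K]_n) (X Y : 'rV[K]_n -> 'rV[K]_n).

Lemma is_derive_line (a v : 'rV[K]_n) (t0 t : K) :
  is_derive t (1 : K) (fun u => a + (u - t0) *: v) v.
Proof.
apply/is_derive_distP => e e0; apply/nbhs_ballP; exists e => // h _ /=.
rewrite opprD addrACA subrr add0r -scalerBl opprB addrA subrK [t + h]addrC addrK.
by rewrite subrr normr0 mulr_ge0 // ltW.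
Qed.

Lemma is_derive_rev (g : K -> 'rV[K]_n) t v :
  is_derive (- t) (1 : K) g v -> is_derive t (1 : K) (g \o -%R) (- v).
Proof.
move=> /is_derive_distP dg; apply/is_derive_distP => e e0.
have /nbhs_ballP[d d0 dge] := dg e e0; apply/nbhs_ballP; exists d => // h.
rewrite -ball_normE /= sub0r normrN => hd.
have := dge (- h); rewrite -ball_normE /= sub0r opprK normrN => /(_ hd).
by rewrite opprD scaleNr opprK scalerN opprK.
Qed.

Lemma integral_curve_rev U X Y (D : set K) (g : K -> 'rV[K]_n) :
  (forall x, U x -> Y x = - X x) -> integral_curve U X D g ->
  integral_curve U Y (-%R @^-1` D) (g \o -%R).
Proof.
move=> XY [oD cD gD]; split.
- by apply: open_comp => // t _; exact: opp_continuous.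
- rewrite (_ : _ @^-1` _ = -%R @` D); last first.
    apply/seteqP; split=> t; first by move=> Dt; exists (- t); rewrite ?opprK.
    by move=> [u Du <-]; rewrite /= opprK.
  apply: connected_continuous_connected => //.
  by apply: continuous_subspaceT; exact: opp_continuous.
- by move=> t /gD[Ut dg]; split=> //=; rewrite XY //; apply: is_derive_rev.
Qed.

Lemma leaf_rev U X Y x : (forall x, U x -> Y x = - X x) -> leaf U X x `<=` leaf U Y x.
Proof.
move=> XY y; elim=> [|D g t0 t1 /(integral_curve_rev _ _ _ _ _ XY) ic D0 D1 _ IH].
  exact: leaf_refl.
have := leaf_step (t0 := - t0) (t1 := - t1) ic; rewrite /= !opprK.
by move=> /(_ x D0 D1 IH).
Qed.

(** Opposite fields have the same integral curves up to reversal of time. The barycentric property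
    makes the two given fields opposite. *)
Lemma foliation_rev U X Y : (forall x, U x -> Y x = - X x) ->
  foliation U X = foliation U Y.
Proof.
move=> XY; apply: eq_imagel => x _; apply/seteqP; split; apply: leaf_rev => //.
by move=> z Uz; rewrite XY // opprK.
Qed.

Lemma integral_curve_continuous U X (D : set K) (g : K -> 'rV[K]_n) :
  integral_curve U X D g -> {within D, continuous g}.
Proof.
move=> [_ _ gD]; apply: continuous_in_subspaceT => t /set_mem /gD[_].
exact: is_derive_continuous.
Qed.

End Flows.

(* [iota] identifies [R] with the real elements of [K], so that real segments can
   be drawn in [K]-vector spaces, whether [K] is [R] or [R[i]]. *)
Section RealLine.
Context {R : realType} {K : numFieldType}.
Variable iota : {rmorphism R -> K}.
Hypothesis norm_iota : forall s, `|iota s| = iota `|s|.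
Hypothesis iota_nneg : forall x : K, 0 <= x -> exists s, iota s = x.

Lemma iota_ge0 s : (0 <= iota s) = (0 <= s).
Proof.
apply/idP/idP => [s0|/ger0_norm <-]; last by rewrite -norm_iota.
have /fmorph_inj -> : iota s = iota `|s| by rewrite -norm_iota ger0_norm.
exact: normr_ge0.
Qed.

Lemma ler_iota s t : (iota s <= iota t) = (s <= t).
Proof. by rewrite -subr_ge0 -rmorphB iota_ge0 subr_ge0. Qed.

Lemma ltr_iota s t : (iota s < iota t) = (s < t).
Proof. by rewrite !lt_neqAle ler_iota fmorph_eq. Qed.

Lemma iota_gt0 s : (0 < iota s) = (0 < s).
Proof. by rewrite -{1}(rmorph0 iota) ltr_iota. Qed.

(** Lets every positive tolerance in [K] be taken real. *)
Lemma iota_pos (x : K) : 0 < x -> exists2 s, 0 < s & iota s = x.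
Proof.
move=> x0; have [s sx] := iota_nneg _ (ltW x0).
by exists s => //; rewrite -iota_gt0 sx.
Qed.

Lemma continuous_iota : continuous iota.
Proof.
move=> s; apply/(@cvgrPdist_lt _ _ _ (nbhs s)) => _ /iota_pos[e e0 <-].
near=> t; rewrite -rmorphB norm_iota ltr_iota.
by near: t; apply: (@cvgr_dist_lt _ _ _ (nbhs s) _ id s).
Unshelve. all: by end_near. Qed.

Section Segment.
Context {V : normedModType K}.
Implicit Types (a w : V).

(** The parameter is real even when [K] is complex: over [0, 1] this is the segment from [a] to
    [a + w], and connectedness of real intervals applies. *)
Definition affine a w (s : R) : V := a + iota s *: w.

Lemma affine0 a w : affine a w 0 = a.
Proof. by rewrite /affine rmorph0 scale0r addr0. Qed.

Lemma affine1 a w : affine a w 1 = a + w.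
Proof. by rewrite /affine rmorph1 scale1r. Qed.

Lemma affineD a w s u : affine (affine a w s) w u = affine a w (s + u).
Proof. by rewrite /affine rmorphD scalerDl addrA. Qed.

Lemma continuous_affine a w : continuous (affine a w).
Proof.
move=> s; apply: cvgD; first exact: cvg_cst.
by apply: cvgZr_tmp; apply: continuous_iota.
Qed.

Lemma connected_affine a w : connected (affine a w @` `[0, 1]).
Proof.
apply: connected_continuous_connected; first exact: segment_connected.
by apply: continuous_subspaceT; apply: continuous_affine.
Qed.

Lemma affine_ball a (r : K) y z s : ball a r y -> ball a r z -> s \in `[0, 1] ->
  ball a r (affine y (z - y) s).
Proof.
rewrite -ball_normE /= in_itv /= => ay az /andP[s0 s1].
(* Strictness will come from the term in [z], whose weight [s] must then be positive. *)
have [->|sN0] := eqVneq s 0; first by rewrite affine0.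
have -> : a - affine y (z - y) s = iota (1 - s) *: (a - y) + iota s *: (a - z).
  rewrite rmorphB rmorph1 scalerBl scale1r -addrA -scalerN -scalerDr.
  by rewrite /affine opprD addrA -scalerN opprB opprB addrA addrNK.
apply: le_lt_trans (ler_normD _ _) _; rewrite !normrZ !norm_iota.
rewrite !ger0_norm // ?subr_ge0 //.
have -> : r = iota (1 - s) * r + iota s * r.
  by rewrite -mulrDl -rmorphD subrK rmorph1 mul1r.
rewrite ler_ltD // ?ler_wpM2l ?iota_ge0 ?subr_ge0 ?(ltW ay) //.
by rewrite ltr_pM2l // iota_gt0 lt_neqAle eq_sym sN0.
Qed.

End Segment.

(* The norm of [g - g t0] along the segment is a real function with derivative 0,
   by the reverse triangle inequality. *)
Lemma derive0_segment (V : normedModType K) (g : K -> V) (t0 t1 : K) :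
  (forall s, s \in `[0, 1] -> is_derive (affine t0 (t1 - t0) s) (1 : K) g 0) ->
  g t1 = g t0.
Proof.
move=> dg; pose w := t1 - t0.
(* Norms in [V] have values in [K]; [N] reads them as reals, for the mean value theorem. *)
have /choice[N hN] : forall v : V, exists s, iota s = `|v|.
  by move=> v; apply: iota_nneg.
pose H s := N (g (affine t0 w s) - g t0).
have NB u v : `|N u - N v| <= N (u - v).
  rewrite -ler_iota -norm_iota rmorphB !hN; exact: ler_dist_dist.
have dH (s : R) : s \in `[0, 1] -> is_derive s (1 : R) H 0.
  move=> s01; apply/is_derive_distP => e e0.
  have w1 : 0 < 1 + `|w| by rewrite ltr_pwDl.
  have /is_derive_distP/(_ (iota e / (1 + `|w|))) := dg _ s01.
  rewrite divr_gt0 ?iota_gt0 // => /(_ isT) near_g.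
  have wcv : iota h * w @[h --> (0 : R)] --> (0 : K).
    have := cvgMr_tmp (b := w) (continuous_iota 0).
    by rewrite rmorph0 mul0r; apply.
  pose S : set K := fun h => `|g (affine t0 w s + h) - g (affine t0 w s) - h *: 0|
      <= iota e / (1 + `|w|) * `|h|.
  have {}near_g : nbhs (0 : R) (fun h => S (iota h * w)) := wcv S near_g.
  apply: (filterS _ near_g) => h; rewrite /S /= !scaler0 !subr0 => le_g.
  apply: (le_trans (NB _ _)); rewrite -ler_iota rmorphM hN -norm_iota.
  rewrite opprB addrA subrK.
  have -> : affine t0 w (s + h) = affine t0 w s + iota h * w.
    by rewrite /affine rmorphD scalerDl addrA.
  apply: (le_trans le_g); rewrite normrM [X in _ * X]mulrC mulrA ler_wpM2r //.
  rewrite -mulrA ler_piMr ?iota_ge0 ?(ltW e0) // ler_pdivrMl // mulr1.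
  by rewrite lerDr.
have MVTH := @MVT_segment R H (fun=> 0) 0 1 ler01.
have dHo (s : R) : s \in `]0, 1[ -> is_derive s (1 : R) H 0.
  by move=> /subset_itv_oo_cc s01; apply: dH.
have {}MVTH := MVTH dHo.
have [|s _] := MVTH.
- by apply: derivable_within_continuous => s /dH[].
rewrite mul0r => /eqP; rewrite subr_eq0 => /eqP H10.
apply/eqP; rewrite -subr_eq0 -normr_eq0 -hN.
have -> : N (g t1 - g t0) = H 1 by rewrite /H affine1 /w [t0 + _]addrC subrK.
by rewrite H10 /H affine0 subrr hN normr0.
Qed.

(** Balls are convex, so the result on segments makes [g] locally constant; connectedness does the
    rest. *)
Lemma derive0_connected (V : normedModType K) (D : set K) (g : K -> V) (t0 : K) :
  open D -> connected D -> D t0 -> (forall t, D t -> is_derive t (1 : K) g 0) ->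
  forall t, D t -> g t = g t0.
Proof.
move=> oD cD Dt0 dg; suff g_loc t : D t -> \forall u \near t, g u = g t.
  apply: (connected_clopen_ind _ _ [set t | g t = g t0] t0 cD Dt0) => // t Dt gt.
    by apply: filterS (g_loc t Dt) => u gu; rewrite /= gu.
  by apply: filterS (g_loc t Dt) => u gu; rewrite /= gu.
move=> Dt.
have /nbhs_ballP[r r0 rD] : nbhs t D by apply: open_nbhs_nbhs.
apply/nbhs_ballP; exists r => // u tu /=.
apply: derive0_segment => s s01; apply/dg/rD.
by apply: affine_ball => //; apply: ballxx.
Qed.


(** The Archimedean property of [R], carried to [K] by [iota]. *)
Lemma natmul_bounded_le0 (x M : K) : (forall k, x *+ k <= M) -> 0 <= x -> x = 0.
Proof.
move=> xM x0; apply/eqP/negPn/negP => xN0.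
have [s s0 sx] : exists2 s, 0 < s & iota s = x by apply: iota_pos; rewrite lt0r xN0.
have [N N0 NM] : exists2 N, 0 <= N & iota N = M.
  have M0 := le_trans (mulrn_wge0 0 x0) (xM 0%N).
  by have [N NM] := iota_nneg _ M0; exists N => //; rewrite -iota_ge0 NM.
have := xM (Num.bound (N / s)).
rewrite -NM -sx -rmorphMn ler_iota -mulr_natr mulrC -ler_pdivlMr //.
by rewrite leNgt archi_boundP // divr_ge0 // ltW.
Qed.

(** * The identity theorem *)

Section Identity.
Context {n m : nat}.
Implicit Types (f : 'rV[K]_n -> 'rV[K]_m).

(* The homogeneous parts of [f] at [a] vanish on [w], by induction on the degree;
   the remainders then bound [f] by every term of a geometric sequence. *)
Lemma accumulating_zeros f a w : analytic_at f a ->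
  (forall d : R, 0 < d ->
     exists u, [/\ u != 0, `|u| < d & f (affine a w u) = 0]) ->
  \forall u \near (0 : R), f (affine a w u) = 0.
Proof.
move=> /analytic_at_expansion[c [rho' [M' [/iota_pos[rho rho0 rhoE] M0 cM]]]] acc.
have [M ME] := iota_nneg _ M0; rewrite -ME -?rhoE in M0 cM; rewrite iota_ge0 in M0.
have [W WE] := iota_nneg _ (normr_ge0 w).
have W0 : 0 <= W by rewrite -iota_ge0 WE.
have W1 : 0 < W + 1 by rewrite ltr_wpDl.
have {}cM u k : `|u| * (W + 1) <= rho ->
    `|f (affine a w u) - \sum_(j < k) iota u ^+ j *: homogeneous_part c j w| <=
      iota (M * (`|u| * (W + 1) / rho) ^+ k).
  move=> urho; have uw : `|iota u *: w| <= iota (`|u| * (W + 1)).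
    by rewrite normrZ norm_iota -WE -rmorphM ler_iota ler_wpM2l // lerDl.
  have := cM (iota u *: w) k (le_trans uw _); rewrite ler_iota => /(_ urho).
  under eq_bigr do rewrite homogeneous_partZ.
  move=> /le_trans; apply; rewrite rmorphM rmorphXn fmorph_div ler_wpM2l ?iota_ge0 //.
  by rewrite lerXn2r ?nnegrE ?divr_ge0 ?iota_ge0 ?mulr_ge0 ?(ltW rho0) ?(ltW W1) //
    ler_wpM2r // invr_ge0 iota_ge0 ltW.
have c0 k : homogeneous_part c k w = 0.
  elim/ltn_ind: k => k IHk; apply/eqP; rewrite -normr_eq0; apply/negPn/negP => pN0.
  have [p p0 pE] : exists2 p, 0 < p & iota p = `|homogeneous_part c k w|.
    by apply: iota_pos; rewrite lt0r pN0 normr_ge0.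
  pose C := M * ((W + 1) / rho) ^+ k.+1.
  have C0 : 0 <= C by rewrite mulr_ge0 // exprn_ge0 // divr_ge0 // ltW.
  have C1 : 0 < C + 1 by rewrite ltr_wpDl.
  (* The first bound keeps [u] in the range of the expansion. At a zero of [f] the parts below [k]
     drop out by induction and the remainder of order [k.+1] gives [p <= |u| * C], against the
     second bound. *)
  have [|u [uN0 + fu0]] := acc (Num.min (rho / (W + 1)) (p / (C + 1))).
    by rewrite lt_min !divr_gt0.
  rewrite lt_min => /andP[]; rewrite ltr_pdivlMr // => /ltW /(cM u k.+1).
  rewrite fu0 sub0r normrN big_ord_recr /= big1 => [|j _]; last by rewrite IHk ?scaler0.
  rewrite add0r normrZ normrX norm_iota -pE -rmorphXn -rmorphM ler_iota.
  rewrite -[ `|u| * _ / _]mulrA exprMn exprS mulrCA -/C.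
  rewrite [ `|u| * _]mulrC -mulrA ler_pM2l ?exprn_gt0 ?normr_gt0 // => pC.
  by rewrite ltNge ler_pdivrMr // (le_trans pC) // ler_wpM2l // lerDl ler01.
(* This radius makes the ratio at most 1/2. As [k <= 2 ^ k], every multiple of the norm of
   [f (affine a w u)] is then at most [M], so that norm is 0. *)
have e0 : 0 < rho / (W + 1) / 2 by rewrite !divr_gt0.
apply: (filterS _ (nbhs0_le e0)) => u u1.
apply/eqP; rewrite -normr_eq0; apply/eqP.
apply: (natmul_bounded_le0 _ (iota M)) => // k.
have urho : `|u| * (W + 1) <= rho / 2 by rewrite -ler_pdivlMr // mulrAC.
have := cM u k (le_trans urho _); rewrite ler_pdivrMr // ler_pMr // ler1n => /(_ isT).
under eq_bigr do rewrite c0 scaler0.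
rewrite big1 // subr0 => fuk.
have q2 : `|u| * (W + 1) / rho <= 2^-1 by rewrite ler_pdivrMr // [leRHS]mulrC.
have q0 : 0 <= `|u| * (W + 1) / rho by rewrite ?divr_ge0 ?mulr_ge0 ?(ltW W1) ?(ltW rho0).
apply: le_trans (ler_wMn2r k fuk) _; rewrite -rmorphMn ler_iota -mulrnAr.
rewrite ler_piMr // -mulr_natl.
apply: (@le_trans _ _ (k%:R * 2^-1 ^+ k)).
  by rewrite ler_wpM2l ?ler0n // lerXn2r ?nnegrE ?invr_ge0.
by rewrite exprVn ler_pdivrMr ?exprn_gt0 // mul1r -natrX ler_nat ltnW // ltn_expl.
Qed.

(** The parameters around which [f] vanishes form an open set. A limit of this set outside it would
    be an accumulation point of zeros, so [f] would vanish around it after all; connectedness of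
    [0, 1] concludes. *)
Lemma vanishing_segment f b w :
  (forall s, s \in `[0, 1] -> analytic_at f (affine b w s)) ->
  (\forall u \near b, f u = 0) -> f (b + w) = 0.
Proof.
move=> fan f0; pose Z : set R := [set s | f (affine b w s) = 0]^°.
suff E : `[0, 1]%classic `&` Z = `[0, 1]%classic.
  have : `[0, 1]%classic (1 : R) by rewrite /= in_itv /= ler01 lexx.
  by rewrite -E => -[_ /nbhs_singleton]; rewrite /= affine1.
apply: segment_connected.
- exists 0; split; first by rewrite /= in_itv /= ler01 lexx.
  rewrite /Z /interior /=.
  have := @continuous_affine _ b w 0 [set u | f u = 0].
  by rewrite affine0; apply.
- by exists Z => //; apply: open_interior.
- exists (closure Z); first exact: closed_closure.
  apply/seteqP; split=> s [s01 Zs]; split=> //; first exact: subset_closure.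
  have [//|sZ] := pselect (Z s).
  have : \forall u \near (0 : R), f (affine (affine b w s) w u) = 0.
    apply: accumulating_zeros => [|d d0]; first exact: fan.
    have [z [Zz sz]] := Zs _ (nbhsx_ballx s d d0).
    exists (z - s); split.
    - by rewrite subr_eq0; apply/eqP => zs; rewrite zs in Zz.
    - by rewrite distrC.
    - by rewrite affineD addrC subrK; exact: nbhs_singleton Zz.
  move=> /nbhs_ballP[d d0 df]; rewrite /Z /interior /=; apply/nbhs_ballP.
  exists d => // z sz /=; rewrite -(subrK s z) addrC -affineD; apply: df.
  by rewrite -ball_normE /= sub0r normrN distrC.
Qed.

(** The interior of the zero set is closed in [U]: a ball in [U] around a limit point contains a
    point [z] of the interior, and every point of the ball is joined to [z] by a segment in the
    ball. *)
Lemma identity_theorem (U : set 'rV[K]_n) f : open U -> connected U ->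
  analytic_on U f -> (exists2 b, U b & \forall u \near b, f u = 0) ->
  forall x, U x -> f x = 0.
Proof.
move=> oU cU fan [b Ub fb0]; pose Z := [set x | f x = 0]^°.
suff <- : U `&` Z = U by move=> x [_ /nbhs_singleton].
apply: cU; first by exists b.
- by exists Z => //; apply: open_interior.
- exists (closure Z); first exact: closed_closure.
  apply/seteqP; split=> a [Ua Za]; split=> //; first exact: subset_closure.
  have /nbhs_ballP[r r0 rU] : nbhs a U by apply: open_nbhs_nbhs.
  have [z [Zz az]] := Za _ (nbhsx_ballx a r r0).
  rewrite /Z /interior /=; apply/nbhs_ballP; exists r => // y ay /=.
  rewrite -(subrK z y) addrC; apply: vanishing_segment => // s s01.
  by apply/fan/rU/affine_ball.
Qed.

End Identity.

(** * Components of the intersection of a line with an open set *)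

Section Lines.
Context {n : nat}.
Variables (U : set 'rV[K]_n) (x v : 'rV[K]_n).
Hypotheses (oU : open U) (v0 : v != 0).

Definition line_through : set 'rV[K]_n := [set x + t *: v | t in [set: K]].
Let C := connected_component (line_through `&` U) x.

Lemma continuous_line : continuous (fun t : K => x + t *: v).
Proof.
move=> t; apply: (@cvgD _ _ _ (nbhs t) _ (fun=> x) (fun u => u *: v)).
  exact: cvg_cst.
by apply: cvgZr_tmp; exact: cvg_id.
Qed.

Lemma segment_component (t t' : K) :
  (forall s, s \in `[0, 1] -> U (x + affine t (t' - t) s *: v)) ->
  C (x + t *: v) -> C (x + t' *: v).
Proof.
move=> tU Ct; apply: (connected_component_trans Ct).
pose S := (fun u => x + u *: v) @` (affine t (t' - t) @` `[0, 1]).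
exists S.
  split.
  - exists t => //; exists 0; first by rewrite /= in_itv /= lexx ler01.
    by rewrite affine0.
  - move=> _ [_ [s s01 <-] <-]; split; last exact: tU.
    by exists (affine t (t' - t) s).
  apply: connected_continuous_connected; first exact: connected_affine.
  by apply: continuous_subspaceT; exact: continuous_line.
exists t' => //; exists 1; first by rewrite /= in_itv /= lexx ler01.
by rewrite affine1 addrC subrK.
Qed.

(** A coordinate in which [v] is nonzero recovers the parameter. This continuous left inverse
    carries topological properties from the line back to the parameters. *)
Lemma line_coordinate : exists2 psi : 'rV[K]_n -> K, continuous psi &
  forall t, psi (x + t *: v) = t.
Proof.
have /existsP[i vi] : [exists i, v 0 i != 0].
  apply: contra_neqT v0 => /existsPn vi; apply/rowP => i; rewrite mxE.
  by apply/eqP; have := vi i; rewrite negbK.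
exists (fun y => (y - x) 0 i / v 0 i) => [y|t].
  have cv : z - x @[z --> y] --> y - x.
    exact: (cvgB cvg_id (cvg_cst x)).
  have cvi := cvg_comp _ _ cv (@coord_continuous K 1 n 0 i (y - x)).
  exact: (cvgMr_tmp (b := (v 0 i)^-1) cvi).
by rewrite addrC addKr mxE mulfK.
Qed.

Lemma component_line y : C y -> exists t, y = x + t *: v.
Proof. by move=> /connected_component_sub[[t _ <-] _]; exists t. Qed.

Lemma component_U y : C y -> U y.
Proof. by move=> /connected_component_sub[]. Qed.

Let D : set K := [set t | C (x + t *: v)].

Lemma line_ball (t : K) : U (x + t *: v) ->
  exists2 r : K, 0 < r & forall u, ball t r u -> U (x + u *: v).
Proof.
move=> Ut; have := @continuous_line t U (open_nbhs_nbhs (conj oU Ut)).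
by move=> /nbhs_ballP[r /= r0 rU]; exists r => // u /rU.
Qed.

Lemma component_domain_open : open D.
Proof.
rewrite openE => t Dt; have [r r0 rU] := line_ball t (component_U _ Dt).
apply/nbhs_ballP; exists r => // u tu; apply: segment_component Dt => s s01.
by apply: rU; apply: affine_ball => //; apply: ballxx.
Qed.

Lemma component_domain_connected : connected D.
Proof.
have [psi psic psiK] := line_coordinate.
have -> : D = psi @` C.
  apply/seteqP; split=> t; first by move=> Dt; exists (x + t *: v).
  by move=> [y Cy <-]; have [u yu] := component_line _ Cy; rewrite yu psiK /D /= -yu.
apply: connected_continuous_connected; first exact: component_connected.
exact: continuous_subspaceT.
Qed.

(** A limit of the component is still on the line, by a closed condition; if it lies in [U], a short
    segment of the line inside [U] joins it to a point of the component. *)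
Lemma component_relatively_closed : U `&` closure C = C.
Proof.
have [psi psic psiK] := line_coordinate.
apply/seteqP; split=> [y [Uy Cy]|y Cy]; last first.
  by split; [exact: component_U | exact: subset_closure].
have yE : y = x + psi y *: v.
  apply/eqP; rewrite -subr_eq0; apply/eqP.
  have cl0 : closed ((fun z => z - (x + psi z *: v)) @^-1` [set 0]).
    have cl1 : closed [set (0 : 'rV[K]_n)].
      apply: accessible_closed_set1; apply: hausdorff_accessible.
      exact: norm_hausdorff.
    apply: preimage_closed cl1 => z _.
    exact: (cvgB cvg_id (cvgD (cvg_cst x) (cvgZr_tmp (psic z)))).
  apply: cl0; apply: closureS Cy => z /component_line[t ->] /=.
  by rewrite psiK subrr.
have [|r r0 rU] := line_ball (psi y); first by rewrite -yE.
have [z [Cz yz]] := Cy _ (psic y _ (nbhsx_ballx (psi y) r r0)).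
have [t zt] := component_line _ Cz.
rewrite yE; apply: (segment_component t); last by rewrite -zt.
move=> s s01; apply/rU/affine_ball => //; last exact: ballxx.
by move: yz; rewrite /= zt psiK.
Qed.

(** Subtracting the affine motion leaves a curve with zero derivative, so [g] is affine. Its image
    is a connected part of the line inside [U] and cannot leave the component. *)
Lemma affine_curve_component (c : K) (E : set K) (g : K -> 'rV[K]_n) t0 :
  integral_curve U (fun=> c *: v) E g -> E t0 -> C (g t0) ->
  forall t, E t -> g t = g t0 + (t - t0) *: (c *: v) /\ C (g t).
Proof.
move=> ig E0 Cg0; have [oE cE gE] := ig.
have gE' t : E t -> g t = g t0 + (t - t0) *: (c *: v).
  move=> Et; apply/eqP; rewrite -subr_eq0; apply/eqP.
  pose w : 'rV[K]_n := c *: v.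
  have := derive0_connected _ E (g - (fun u => g t0 + (u - t0) *: w)) t0 oE cE E0 _ _ Et.
  rewrite !fctE subrr scale0r addr0 subrr; apply=> u Eu.
  rewrite -(subrr w); apply: is_deriveB; last exact: is_derive_line.
  by have [] := gE u Eu.
move=> t Et; split; first exact: gE'.
apply: (connected_component_trans Cg0); exists (g @` E); last by exists t.
split; first by exists t0.
- move=> _ [u Eu <-]; split; last by have [] := gE u Eu.
  have [s gs] := component_line _ Cg0.
  exists (s + (u - t0) * c) => //.
  by rewrite gE' // gs scalerDl addrA scalerA.
apply: connected_continuous_connected => //.
exact: integral_curve_continuous ig.
Qed.

End Lines.

(** * The barycentric property *)

Section Barycentric.
Context {n : nat}.
Variables (U : set 'rV[K]_n) (X : 'I_2 -> 'rV[K]_n -> 'rV[K]_n).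
Hypothesis openU : open U.
Hypothesis analyticX : forall k, analytic_on U (X k).
Hypothesis barycentricX : barycentric U X.

Lemma barycentric_opp x : U x -> X 1 x = - X 0 x.
Proof.
move=> Ux; have [D [phi [flow sum0]]] := barycentricX x Ux.
have [_ D0 _] := flow 0.
have := sum0 0 D0; rewrite big_ord_recl big_ord1.
have -> : lift ord0 ord0 = 1 :> 'I_2 by apply: val_inj.
have [_ _ ->] := flow ord0; have [_ _ ->] := flow 1.
by move/eqP; rewrite addrC addr_eq0 => /eqP.
Qed.

(** The factor, 1 or -1, that expresses [X k] through [X 0] and lets both fields be treated at
    once. *)
Definition flow_sign (k : 'I_2) : K := (-1) ^+ k.

Lemma flow_signK k : flow_sign k * flow_sign k = 1.
Proof. by rewrite -exprMn mulrNN mulr1 expr1n. Qed.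

Lemma barycentric_sign k x : U x -> X k x = flow_sign k *: X 0 x.
Proof.
move=> Ux; case: k => [[|[|//]] lt2]; rewrite /flow_sign /=.
  by rewrite expr0 scale1r; congr (X _ x); apply: val_inj.
rewrite expr1 scaleN1r -barycentric_opp //; congr (X _ x); exact: val_inj.
Qed.

Lemma is_derive_along_field k (g : K -> 'rV[K]_n) t : U (g t) ->
  is_derive t (1 : K) g (X k (g t)) -> is_derive t (1 : K) (X 0 \o g) 0.
Proof.
move=> Ug dg; have [L [LN dL]] := is_derive_analytic_comp _ _ (analyticX 0 _ Ug).
(* [L] is odd and [X k] is [X 0] up to sign, so the direction of [X 0] decides for both fields. *)
suff L0 : L (X 0 (g t)) = 0.
  have Lk : L (X k (g t)) = 0.
    case: k dg => [[|[|//]] lt2] _.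
      by rewrite -[RHS]L0; congr (L (X _ _)); apply: val_inj.
    rewrite -[RHS]oppr0 -L0 -LN -barycentric_opp //; congr (L (X _ _)); exact: val_inj.
  by rewrite -Lk; apply: dL.
have [D [phi [flow sum0]]] := barycentricX _ Ug.
have [[oD _ phi0] D0 phi00] := flow 0; have [[_ _ phi1] _ phi10] := flow 1.
have d0 : is_derive (0 : K) (1 : K) (X 0 \o phi 0) (L (X 0 (g t))).
  by apply: dL => //; rewrite -phi00; have [] := phi0 0 D0.
have d1 : is_derive (0 : K) (1 : K) (X 0 \o phi 1) (- L (X 0 (g t))).
  rewrite -LN -barycentric_opp //.
  by apply: dL => //; rewrite -phi10; have [] := phi1 0 D0.
(* Since [X 1] is opposite to [X 0], the vanishing sum says that [X 0] agrees along the two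
   flows. *)
have E01 : \forall u \near (0 : K), (X 0 \o phi 0) u = (X 0 \o phi 1) u.
  apply: filterS (open_nbhs_nbhs (conj oD D0)) => u Du /=.
  have := sum0 u Du; rewrite big_ord_recl big_ord1.
  have -> : lift ord0 ord0 = 1 :> 'I_2 by apply: val_inj.
  rewrite (barycentric_opp (phi 1 u)); last by have [] := phi1 u Du.
  by move/eqP; rewrite subr_eq0 => /eqP.
have [_ Dv0] := near_eq_is_derive E01 d0; have [_ Dv1] := d1.
have : L (X 0 (g t)) = - L (X 0 (g t)) by rewrite -Dv1.
move/eqP; rewrite -addr_eq0 -mulr2n -scaler_nat scaler_eq0 pnatr_eq0 /=.
by move/eqP.
Qed.

Lemma field_constant_on_curve k D (g : K -> 'rV[K]_n) t0 :
  integral_curve U (X k) D g -> D t0 -> forall t, D t -> forall j, X j (g t) = X j (g t0).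
Proof.
move=> [oD cD gD] D0 t Dt j.
have [Ut _] := gD t Dt; have [U0 _] := gD t0 D0.
rewrite (barycentric_sign j (g t)) // (barycentric_sign j (g t0)) //; congr (_ *: _).
apply: (derive0_connected _ D (X 0 \o g) t0 oD cD D0 _ t Dt) => u Du.
by have [Ugu dgu] := gD u Du; apply: is_derive_along_field dgu.
Qed.

(** Openness is continuity. A point of [U] outside the closure would have a neighbourhood where
    [X k] vanishes, forcing [X k] to vanish on all of [U]. *)
Lemma regular_generic k : connected U -> (exists x, U x /\ X k x <> 0) ->
  generic_in U (regular_points U (X k)).
Proof.
move=> cU [x [Ux Xx]]; split; first by move=> y [].
- rewrite openE => y [Uy Xy]; rewrite /interior /=.
  have nU : nbhs y U by apply: open_nbhs_nbhs.
  apply: (filterI nU).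
  have nX : \forall z \near y, X k z <> 0.
    by apply: near_neq; [apply/analytic_at_continuous/analyticX | apply/eqP].
  by apply: (filterS _ nX) => z /eqP.
- move=> y Uy; apply: contrapT => ycl; apply: Xx.
  apply: (identity_theorem U (X k) openU cU (analyticX k) _ x Ux).
  exists y => //.
  have [B nB WB] : exists2 B, nbhs y B & regular_points U (X k) `&` B = set0.
    apply: contrapT => H; apply: ycl => B nB; apply/set0P/eqP => WB.
    by apply: H; exists B.
  have nU : nbhs y U by apply: open_nbhs_nbhs.
  apply: filterS (filterI nU nB) => z [Uz Bz].
  apply: contrapT => Xz; have : set0 z by rewrite -WB; split=> //; split=> //; apply/eqP.
  by [].
Qed.

(** * The leaf through a regular point *)

Section Leaf.
Variables (k : 'I_2) (x : 'rV[K]_n).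
Hypotheses (Ux : U x) (Xx : X k x != 0).
Let v := X k x.
Let C := connected_component (line_through x v `&` U) x.

Lemma component_self : C x.
Proof.
apply: connected_component_refl; split=> //; exists 0 => //.
by rewrite scale0r addr0.
Qed.

Lemma field_constant_on_component y j : C y -> X j y = X j x.
Proof.
move=> Cy; have Uy := component_U _ _ _ _ Cy.
rewrite (barycentric_sign j y) // (barycentric_sign j x) //; congr (_ *: _).
have [t yE] := component_line _ _ _ _ Cy; rewrite yE in Cy *.
pose D : set K := [set t | C (x + t *: v)].
have D0 : D 0 by rewrite /D /= scale0r addr0; exact: component_self.
apply: (connected_clopen_ind _ D [set t | X 0 (x + t *: v) = X 0 x] 0
  (component_domain_connected U x v Xx) D0) => //=.
- by rewrite scale0r addr0.
(* Where [X 0] has the value [X 0 x], the local flow of [X k] is affine with velocity [v]: it sweeps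
   the nearby points of the line, and [X 0] is constant along it. *)
- move=> s Ds Xs.
  have Us := component_U _ _ _ _ Ds.
  have [E [phi [flow _]]] := barycentricX _ Us.
  have [ic E0 phi0] := flow k; have [oE _ phiE] := ic.
  have Xconst := field_constant_on_curve _ _ _ _ ic E0.
  have ick : integral_curve U (fun=> 1 *: v) E (phi k).
    case: ic => _ cE _; split=> // u Eu; have [Uu du] := phiE u Eu.
    split=> //; rewrite scale1r /v; rewrite Xconst // phi0 in du.
    by rewrite (barycentric_sign k x Ux) -Xs -(barycentric_sign k _ Us).
  have := affine_curve_component U x v _ _ _ _ ick E0.
  rewrite phi0 => /(_ Ds) phiC.
  have nE : nbhs (0 : K) E by apply: open_nbhs_nbhs.
  have /nbhs_ballP[r r0 rE] := nE.
  apply/nbhs_ballP; exists r => // u; rewrite -ball_normE /= distrC => ur.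
  have Eu : E (u - s) by apply: rE; rewrite -ball_normE /= sub0r normrN.
  have [phiu _] := phiC _ Eu.
  have -> : x + u *: v = phi k (u - s).
    by rewrite phiu subr0 scale1r -addrA -scalerDl [s + _]addrC subrK.
  by rewrite Xconst // phi0 Xs.
- move=> s Ds Xs; have Us := component_U _ _ _ _ Ds.
  have nX : \forall z \near x + s *: v, X 0 z <> X 0 x.
    by apply: near_neq => //; apply/analytic_at_continuous/analyticX.
  exact: (continuous_line x v s _ nX).
Qed.

Lemma field_on_component j y : C y -> X j y = (flow_sign j * flow_sign k) *: v.
Proof.
move=> Cy; rewrite field_constant_on_component // /v (barycentric_sign k x) //.
by rewrite scalerA -mulrA flow_signK mulr1 -barycentric_sign.
Qed.

(** A curve of [X j] sees a constant field, equal to its value on [C]. Conversely, a curve of the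
    constant field that meets [C] stays in [C], where [X j] has that value. *)
Lemma same_flow_component j :
  same_flow_on U C (X j) (fun=> (flow_sign j * flow_sign k) *: v).
Proof.
move=> D g t0 D0 Cg; split=> ic; have [oD cD gD] := ic; split=> // t Dt.
  have [Ut dt] := gD t Dt; split=> //.
  by rewrite -(field_on_component _ _ Cg) -(field_constant_on_curve _ _ _ _ ic D0 _ Dt).
have [Ut dt] := gD t Dt; split=> //.
have [_ Ct] := affine_curve_component U x v _ _ _ _ ic D0 Cg t Dt.
by rewrite (field_on_component _ _ Ct).
Qed.

(** No arc of a chain leaves the component. Conversely, the line parametrised over the whole
    component is a single integral curve, reaching every point from [x]. *)
Lemma leaf_component : leaf U (X k) x = C.
Proof.
apply/seteqP; split=> y.
  elim=> [|D g t0 t1 ic D0 D1 _ Cg0]; first exact: component_self.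
  have /(same_flow_component k D g t0 D0 Cg0) ic' := ic.
  by have [] := affine_curve_component U x v _ _ _ _ ic' D0 Cg0 t1 D1.
move=> Cy; have [t yE] := component_line _ _ _ _ Cy.
pose D : set K := [set t | C (x + t *: v)].
have D0 : D 0 by rewrite /D /= scale0r addr0; exact: component_self.
have Dt : D t by rewrite /D /= -yE.
have ic : integral_curve U (X k) D (fun t => x + t *: v).
  split.
  - exact: component_domain_open.
  - exact: component_domain_connected.
  - move=> s Ds; split; first exact: component_U Ds.
    rewrite (field_constant_on_component _ k Ds).
    have := is_derive_line x v 0 s.
    by under eq_fun do rewrite subr0.
have := leaf_step ic D0 Dt; rewrite scale0r addr0 -yE; apply.
exact: leaf_refl.
Qed.

End Leaf.

Lemma barycentric_straight k x : regular_points U (X k) x ->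
  exists L : set 'rV[K]_n,
    [/\ is_line L, L x,
        U `&` closure (leaf U (X k) x) = connected_component (L `&` U) x
      & forall j, exists v : 'rV[K]_n,
          same_flow_on U (connected_component (L `&` U) x) (X j) (fun=> v)].
Proof.
move=> [Ux Xx]; exists (line_through x (X k x)); split.
- by exists x, (X k x).
- by exists 0 => //; rewrite scale0r addr0.
- by rewrite leaf_component // component_relatively_closed.
- by move=> j; eexists; apply: same_flow_component.
Qed.

End Barycentric.

End RealLine.

(** In the order of [R[i]] a nonnegative element is real, so the usual embedding of [R] works; over
    [R] the identity does. *)
Lemma scalars_real_line (R : realType) (g : ground) :
  exists iota : {rmorphism R -> scalars R g},
    (forall s, `|iota s| = iota `|s|) /\
    (forall x : scalars R g, 0 <= x -> exists s, iota s = x).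
Proof.
case: g => /=.
  by exists idfun; split=> // x _; exists x.
exists (real_complex R); split=> [s|x x0].
  by rewrite normc_def /= expr0n addr0 sqrtr_sqr.
by exists (complex.Re x); apply: RRe_real; apply: ger0_real.
Qed.

Theorem theorem1 (R : realType) (g : ground) (n : nat)
    (U : set 'rV[scalars R g]_n)
    (X : 'I_2 -> 'rV[scalars R g]_n -> 'rV[scalars R g]_n)
    (openU : open U) (connectedU : connected U)
    (analyticX : forall k, analytic_on U (X k))
    (distinctX : exists x, U x /\ X 0 x <> X 1 x)
    (nonzeroX : forall k, exists x, U x /\ X k x <> 0)
    (barycentricX : barycentric U X) :
  [/\ foliation U (X 0) = foliation U (X 1),
      forall k, generic_in U (regular_points U (X k))
    & forall k x, regular_points U (X k) x ->
        exists L : set 'rV[scalars R g]_n,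
          [/\ is_line L,
              L x,
              U `&` closure (leaf U (X k) x) = connected_component (L `&` U) x
            & forall j, exists v : 'rV[scalars R g]_n,
                same_flow_on U (connected_component (L `&` U) x)
                  (X j) (fun=> v)]].
Proof.
have [iota [norm_iota iota_nneg]] := scalars_real_line R g.
split=> [|k|k x].
- by apply: foliation_rev => x; apply: barycentric_opp.
- by apply: (regular_generic iota).
- by apply: (barycentric_straight iota).
Qed.
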